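(* For any real $a,b,\mu,\nu\geq1$ and any $z\in\mathbb{D}$, the following inequality holds: $$\left|\mathbb{W}_{(\mu,a),(\nu,b)}(z)\right|\leq |z|\;{}_1F_2(1;a,b;|z|).$$
   Context: $\mathbb{D}=\{z\in\mathbb{C}:|z|<1\}$. The normalized four parameters Wright function is $$\mathbb{W}_{(\mu,a),(\nu,b)}(z)=\sum_{k=0}^{\infty}\frac{\Gamma(a)\Gamma(b)}{\Gamma(a+k\mu)\Gamma(b+k\nu)}\,z^{k+1}.$$ The hypergeometric function is ${}_1F_2(c;a,b;x)=\sum_{k=0}^{\infty}\frac{(c)_k}{(a)_k(b)_k}\frac{x^k}{k!}$, with Pochhammer symbol $(\alpha)_0=1$, $(\alpha)_k=\alpha(\alpha+1)\cdots(\alpha+k-1)$. *)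

(* Defs.v *)
From Stdlib Require Import Reals Factorial.
From Coquelicot Require Import Coquelicot.
Open Scope R_scope.

(* Euler's integral of the second kind, improper at both ends; it represents
   the Gamma function for [0 < x] only. *)
Definition Gamma (x : R) : R :=
  RInt_gen (fun t => Rpower t (x - 1) * exp (- t))
    (at_right 0) (Rbar_locally p_infty).

(* The complex counterpart of [Series]: the limit of the partial sums in [C],
   with an unspecified value when they diverge. *)
Definition CSeries (u : nat -> C) : C :=
  @iota C_CompleteNormedModule (fun l : C => is_series u l).

Definition Wright_coef (mu a nu b : R) (k : nat) : R :=
  (Gamma a * Gamma b) / (Gamma (a + INR k * mu) * Gamma (b + INR k * nu)).

Definition Wright (mu a nu b : R) (z : C) : C :=
  CSeries (fun k => (RtoC (Wright_coef mu a nu b k) * Cpow z (k + 1))%C).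

Fixpoint Pochhammer (x : R) (k : nat) : R :=
  match k with
  | O => 1
  | S j => Pochhammer x j * (x + INR j)
  end.

Definition hyp1F2 (c a b x : R) : R :=
  Series (fun k => Pochhammer c k / (Pochhammer a k * Pochhammer b k)
                   * (x ^ k / INR (fact k))).

(* Main.v *)
Require Import Defs.
From Stdlib Require Import Reals.
From Coquelicot Require Import Coquelicot.
From Stdlib Require Import Lra Factorial.
Open Scope R_scope.

(** Since [(1)_k = k!], it suffices to show [Gamma (a + k mu) >= (a)_k Gamma a],
    that is [Gamma (a + k mu) >= Gamma (a + k)].  For [1 <= k] both arguments are
    at least [2], and [Gamma] is nondecreasing there: for [1 <= p <= q] and [0 < t],
    [t^q - t^p >= (q - p) (t - 1)], and the right-hand side integrates to
    [(q - p) (Gamma 2 - Gamma 1) = 0] against [exp (-t)]. *)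

(** * Improper integrals over the positive half-line *)

Local Notation is_RInt_pos f l :=
  (is_RInt_gen f (at_right 0) (Rbar_locally p_infty) l).

(** The index is the exponent itself, so [Gamma x] corresponds to [p = x - 1]. *)
Definition Gamma_integrand (p t : R) : R := Rpower t p * exp (- t).

(** Turns facts known on the open half-line into facts that hold eventually for the pair of
    endpoints, which is the form [is_RInt_gen] asks for. *)
Lemma eventually_pos_interval (m M : R) : 0 < m ->
  filter_prod (at_right 0) (Rbar_locally p_infty)
    (fun ab => 0 < fst ab <= m /\ M <= snd ab /\ fst ab <= snd ab).
Proof.
intros hm.
apply Filter_prod with (fun u => 0 < u <= m) (fun v => Rmax m M < v).
- exists (mkposreal m hm); intros y Hy Hy0.
  unfold ball in Hy; simpl in Hy; unfold AbsRing_ball, abs, minus, plus, opp in Hy.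
  simpl in Hy; apply Rabs_def2 in Hy; lra.
- now exists (Rmax m M).
- intros u v Hu Hv; simpl.
  pose proof (Rmax_l m M); pose proof (Rmax_r m M); lra.
Qed.

(** Fundamental theorem of calculus with limits at both ends. [is_RInt_gen_Derive] integrates
    [Derive F], so [f] is first exchanged for it, and continuity is carried over on the ball of
    radius [x] around [x], where the two agree. *)
Lemma is_RInt_pos_primitive (F f : R -> R) (la lb : R) :
  (forall x, 0 < x -> is_derive F x (f x)) ->
  (forall x, 0 < x -> continuous f x) ->
  filterlim F (at_right 0) (locally la) ->
  filterlim F (Rbar_locally p_infty) (locally lb) ->
  is_RInt_pos f (lb - la).
Proof.
intros HF Hf Ha Hb.
apply is_RInt_gen_ext with (Derive F).
- generalize (eventually_pos_interval 1 1 Rlt_0_1); apply filter_imp.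
  intros [u v] (H1 & H2 & H3) x Hx; simpl in *.
  rewrite Rmin_left in Hx by lra.
  apply is_derive_unique, HF; lra.
- apply is_RInt_gen_Derive; try assumption.
  + generalize (eventually_pos_interval 1 1 Rlt_0_1); apply filter_imp.
    intros [u v] (H1 & H2 & H3) x Hx; simpl in *.
    rewrite Rmin_left in Hx by lra.
    exists (f x); apply HF; lra.
  + generalize (eventually_pos_interval 1 1 Rlt_0_1); apply filter_imp.
    intros [u v] (H1 & H2 & H3) x Hx; simpl in *.
    rewrite Rmin_left in Hx by lra.
    assert (hx : 0 < x) by lra.
    apply continuous_ext_loc with f; [|now apply Hf].
    exists (mkposreal x hx); intros y Hy.
    unfold ball in Hy; simpl in Hy; unfold AbsRing_ball, abs, minus, plus, opp in Hy.
    simpl in Hy; apply Rabs_def2 in Hy.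
    symmetry; apply is_derive_unique, HF; lra.
Qed.

(** Monotone convergence: enlarging the interval increases the integral of a nonnegative function,
    so the supremum over compact subintervals is the limit. *)
Lemma ex_RInt_pos_bounded (f : R -> R) (M : R) :
  (forall x, 0 < x -> continuous f x) ->
  (forall x, 0 < x -> 0 <= f x) ->
  (forall u v, 0 < u <= v -> RInt f u v <= M) ->
  exists l, is_RInt_pos f l.
Proof.
intros Hc Hp HM.
assert (Hex : forall u v, 0 < u -> 0 < v -> ex_RInt f u v).
{ intros u v Hu Hv; apply (ex_RInt_continuous (V := R_CompleteNormedModule)).
  intros z Hz; apply Hc.
  apply Rlt_le_trans with (2 := proj1 Hz); now apply Rmin_pos. }
destruct (completeness (fun y => exists u v, 0 < u <= v /\ y = RInt f u v))
  as [l [Hub Hlub]].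
- exists M; intros y (u & v & H & ->); now apply HM.
- exists (RInt f 1 1), 1, 1; split; [lra|reflexivity].
- exists l.
  intros P [eps HP]; unfold filtermapi.
  (* One interval brings the integral within [eps] of the supremum; every interval containing it
     then does as well. *)
  assert (exists u v, 0 < u <= v /\ l - eps < RInt f u v) as (u & v & Huv & Hl).
  { apply Classical_Prop.NNPP; intros Hn.
    assert (l <= l - eps); [|destruct eps as [e He]; simpl in *; lra].
    apply Hlub; intros y (u & v & H & ->).
    apply Rnot_lt_le; intros Hlt; apply Hn; now exists u, v. }
  generalize (eventually_pos_interval u v (proj1 Huv)); apply filter_imp.
  intros [u' v'] (H1 & H2 & H3); simpl in *.
  exists (RInt f u' v'); split.
  + apply (RInt_correct (V := R_CompleteNormedModule)), Hex; lra.
  + apply HP.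
    assert (Hle : RInt f u v <= RInt f u' v').
    { rewrite <- (RInt_Chasles (V := R_CompleteNormedModule) f u' u v')
        by (apply Hex; lra).
      rewrite <- (RInt_Chasles (V := R_CompleteNormedModule) f u v v')
        by (apply Hex; lra).
      assert (0 <= RInt f u' u)
        by (apply RInt_ge_0; [lra|apply Hex; lra|intros; apply Hp; lra]).
      assert (0 <= RInt f v v')
        by (apply RInt_ge_0; [lra|apply Hex; lra|intros; apply Hp; lra]).
      unfold plus; simpl; lra. }
    assert (RInt f u' v' <= l) by (apply Hub; exists u', v'; split; [lra|reflexivity]).
    unfold ball; simpl; unfold AbsRing_ball, abs, minus, plus, opp; simpl.
    apply Rabs_def1; destruct eps as [e He]; simpl in *; lra.
Qed.

(** Here [f] bounds its own norm, so [RInt_gen_norm] with [f] in both roles gives [norm l <= l]. *)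
Lemma is_RInt_pos_ge_0 (f : R -> R) (l : R) :
  (forall x, 0 < x -> 0 <= f x) -> is_RInt_pos f l -> 0 <= l.
Proof.
intros Hf Hl.
apply Rle_trans with (norm l); [apply norm_ge_0|].
apply (RInt_gen_norm (V := R_CompleteNormedModule)
  (Fa := at_right 0) (Fb := Rbar_locally p_infty) f f l l);
  try assumption.
- generalize (eventually_pos_interval 1 1 Rlt_0_1); apply filter_imp; tauto.
- generalize (eventually_pos_interval 1 1 Rlt_0_1); apply filter_imp.
  intros [u v] (H1 & H2 & H3) x Hx; simpl in *.
  unfold norm; simpl; unfold abs; simpl.
  rewrite Rabs_pos_eq; [lra|apply Hf; lra].
Qed.

(** * Bounds, derivative and limits of the Gamma integrand *)

Lemma exp_le (x y : R) : x <= y -> exp x <= exp y.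
Proof. intros [H| ->]; [left; now apply exp_increasing|lra]. Qed.

Lemma ln_le_sub_1 (t : R) : 0 < t -> ln t <= t - 1.
Proof.
intros Ht; pose proof (exp_ineq1_le (ln t)) as H.
rewrite exp_ln in H by assumption; lra.
Qed.

Lemma Gamma_integrand_pos (p t : R) : 0 < Gamma_integrand p t.
Proof. apply Rmult_lt_0_compat; apply exp_pos. Qed.

(** With [s = t / (2 * (p + 1))], the bound [ln s <= s] yields [p * ln s <= p * s <= t / 2], and [C]
    collects the remaining factor [(2 * (p + 1)) ^ p]. Taking [p + 1] instead of [p] keeps the
    divisor positive at [p = 0]. *)
Lemma Gamma_integrand_le (p : R) : 0 <= p ->
  exists C, 0 < C /\
    forall t, 0 < t -> Gamma_integrand p t <= C * exp (- (t / 2)).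
Proof.
intros Hp.
exists (exp (p * ln (2 * (p + 1)))); split; [apply exp_pos|].
intros t Ht.
unfold Gamma_integrand, Rpower; rewrite <- !exp_plus.
set (s := t / (2 * (p + 1))).
assert (Hs : 0 < s) by (apply Rdiv_lt_0_compat; lra).
assert (Ets : t = s * (2 * (p + 1))) by (unfold s; field; lra).
assert (Hln : ln t = ln s + ln (2 * (p + 1)))
  by (rewrite Ets at 1; apply ln_mult; lra).
assert (p * ln s <= p * s)
  by (apply Rmult_le_compat_l; [lra|pose proof (ln_le_sub_1 s Hs); lra]).
assert (p * s <= t / 2) by (rewrite Ets; lra).
apply exp_le; rewrite Hln; lra.
Qed.

Lemma is_derive_Rpower (p t : R) : 0 < t ->
  is_derive (fun u => Rpower u p) t (p * Rpower t (p - 1)).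
Proof. intros Ht; now apply is_derive_Reals, derivable_pt_lim_power. Qed.

(** Integrated over the half-line, this identity becomes the functional equation of [Gamma]. *)
Lemma is_derive_Gamma_integrand (p t : R) : 0 < t ->
  is_derive (Gamma_integrand p) t
    (p * Gamma_integrand (p - 1) t - Gamma_integrand p t).
Proof.
intros Ht; unfold Gamma_integrand.
evar_last.
- apply is_derive_mult with (g := fun u => exp (- u)) (dg := - exp (- t)).
  + now apply is_derive_Rpower.
  + auto_derive; [exact I|ring].
  + intros; apply Rmult_comm.
- unfold plus, mult; simpl; ring.
Qed.

Lemma continuous_Gamma_integrand (p t : R) : 0 < t ->
  continuous (Gamma_integrand p) t.
Proof.
intros Ht; apply (ex_derive_continuous (Gamma_integrand p)).
eexists; now apply is_derive_Gamma_integrand.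
Qed.

Lemma filterlim_exp_opp_div_p_infty (c : R) : 0 < c ->
  filterlim (fun t => exp (- (t / c))) (Rbar_locally p_infty) (locally 0).
Proof.
intros Hc.
apply filterlim_comp with (Rbar_locally m_infty); [|exact is_lim_exp_m].
intros P [M HM]; exists (- M * c); intros t Ht; apply HM.
apply Ropp_lt_cancel; rewrite Ropp_involutive.
now apply Rlt_div_r.
Qed.

Lemma filterlim_Gamma_integrand_p_infty (p : R) : 0 <= p ->
  filterlim (Gamma_integrand p) (Rbar_locally p_infty) (locally 0).
Proof.
intros Hp; destruct (Gamma_integrand_le p Hp) as (C & HC & HCt).
apply filterlim_locally; intros eps.
assert (He : 0 < eps / C) by (apply Rdiv_lt_0_compat; [apply cond_pos|assumption]).
pose proof (proj1 (filterlim_locally (F := Rbar_locally p_infty) _ _)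
  (filterlim_exp_opp_div_p_infty 2 ltac:(lra)) (mkposreal _ He)) as [M HM].
exists (Rmax 0 M); intros t Ht.
pose proof (Rmax_l 0 M); pose proof (Rmax_r 0 M).
specialize (HM t ltac:(lra)); specialize (HCt t ltac:(lra)).
pose proof (Gamma_integrand_pos p t).
unfold ball in *; simpl in *; unfold AbsRing_ball, abs, minus, plus, opp in *.
simpl in *; apply Rabs_def2 in HM; destruct HM as [HM _].
apply Rabs_def1; [|destruct eps; simpl in *; lra].
assert (C * exp (- (t / 2)) < C * (eps / C)) by (apply Rmult_lt_compat_l; lra).
replace (C * (eps / C)) with (pos eps) in * by (field; lra); lra.
Qed.

(** For [0 < t < 1] and [1 <= p], the integrand is at most [t], which is why [Rmin 1 eps] serves as
    radius. *)
Lemma filterlim_Gamma_integrand_0 (p : R) : 1 <= p ->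
  filterlim (Gamma_integrand p) (at_right 0) (locally 0).
Proof.
intros Hp; apply filterlim_locally; intros eps.
assert (Hm : 0 < Rmin 1 eps) by (apply Rmin_pos; [lra|apply cond_pos]).
exists (mkposreal _ Hm); intros t Ht Ht0.
pose proof (Rmin_l 1 eps); pose proof (Rmin_r 1 eps).
pose proof (Gamma_integrand_pos p t).
unfold ball in *; simpl in *; unfold AbsRing_ball, abs, minus, plus, opp in *.
simpl in *; apply Rabs_def2 in Ht.
apply Rabs_def1; [|destruct eps; simpl in *; lra].
assert (Hln : ln t <= 0) by (pose proof (ln_le_sub_1 t Ht0); lra).
assert (Hle : Gamma_integrand p t <= t); [|lra].
unfold Gamma_integrand, Rpower; rewrite <- exp_plus.
apply Rle_trans with (exp (ln t)); [|rewrite exp_ln; lra].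
apply exp_le.
assert (0 <= (p - 1) * - ln t) by (apply Rmult_le_pos; lra); lra.
Qed.

(** * Convergence of Euler's integral and the functional equation *)

(** [Gamma] is a total function built on [RInt_gen], so its value is meaningful only once
    convergence is known. For [1 <= x] the exponent [x - 1] is nonnegative and the exponential
    majorant applies on the whole half-line. *)
Lemma Gamma_correct (x : R) : 1 <= x ->
  is_RInt_pos (Gamma_integrand (x - 1)) (Gamma x).
Proof.
intros Hx.
apply (RInt_gen_correct (V := R_CompleteNormedModule)
  (Fa := at_right 0) (Fb := Rbar_locally p_infty)); try typeclasses eauto.
destruct (Gamma_integrand_le (x - 1) ltac:(lra)) as (C & HC & HCt).
apply ex_RInt_pos_bounded with (2 * C).
- intros; now apply continuous_Gamma_integrand.
- intros; apply Rlt_le, Gamma_integrand_pos.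
- intros u v Huv.
  (* The majorant has primitive [-2 * C * exp (- (t / 2))], hence the bound [2 * C] on all its
     integrals. *)
  assert (Hi : is_RInt (fun t => C * exp (- (t / 2))) u v
      (-2 * C * exp (- (v / 2)) - -2 * C * exp (- (u / 2)))).
  { apply (is_RInt_derive (V := R_CompleteNormedModule)
      (fun t => -2 * C * exp (- (t / 2)))).
    - intros t _; auto_derive; [exact I|unfold Rdiv; field].
    - intros t _; apply (ex_derive_continuous (fun t => C * exp (- (t / 2)))).
      now auto_derive. }
  apply Rle_trans with (RInt (fun t => C * exp (- (t / 2))) u v).
  + apply RInt_le; [lra| |now eexists; apply Hi|intros; apply HCt; lra].
    apply (ex_RInt_continuous (V := R_CompleteNormedModule)); intros z Hz.
    rewrite Rmin_left in Hz by lra.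
    apply continuous_Gamma_integrand; lra.
  + rewrite (is_RInt_unique _ _ _ _ Hi).
    assert (0 < C * exp (- (v / 2))) by (apply Rmult_lt_0_compat; [lra|apply exp_pos]).
    assert (C * exp (- (u / 2)) <= C * 1); [|lra].
    apply Rmult_le_compat_l; [lra|].
    rewrite <- exp_0; apply exp_le; lra.
Qed.

Lemma is_RInt_pos_unique (f : R -> R) (l l' : R) :
  is_RInt_pos f l -> is_RInt_pos f l' -> l = l'.
Proof.
intros H H'.
rewrite <- (is_RInt_gen_unique (V := R_CompleteNormedModule) _ _ H).
now rewrite <- (is_RInt_gen_unique (V := R_CompleteNormedModule) _ _ H').
Qed.

(** Integration by parts in disguise: the derivative of [Gamma_integrand x] integrates to 0, since
    this function vanishes at both ends. *)
Lemma Gamma_succ (x : R) : 1 <= x -> Gamma (x + 1) = x * Gamma x.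
Proof.
intros Hx.
assert (H0 : is_RInt_pos
  (fun t => x * Gamma_integrand (x - 1) t - Gamma_integrand x t) (0 - 0)).
{ apply is_RInt_pos_primitive with (Gamma_integrand x).
  - intros; now apply is_derive_Gamma_integrand.
  - intros t Ht.
    apply (continuous_minus (fun t => x * Gamma_integrand (x - 1) t)
      (Gamma_integrand x)); [|now apply continuous_Gamma_integrand].
    apply (continuous_scal_r x (Gamma_integrand (x - 1))).
    now apply continuous_Gamma_integrand.
  - now apply filterlim_Gamma_integrand_0.
  - apply filterlim_Gamma_integrand_p_infty; lra. }
assert (H1 := Gamma_correct (x + 1) ltac:(lra)).
replace (x + 1 - 1) with x in H1 by ring.
pose proof (is_RInt_gen_minus _ _ _ _
  (is_RInt_gen_scal _ x _ (Gamma_correct x Hx)) H1) as H2.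
pose proof (is_RInt_pos_unique _ _ _ H0 H2) as H3.
unfold minus, plus, opp, scal, mult in H3; simpl in H3.
unfold mult in H3; simpl in H3; lra.
Qed.

Lemma Gamma_1 : Gamma 1 = 1.
Proof.
assert (H : is_RInt_pos (Gamma_integrand (1 - 1)) (0 - -1)).
{ apply is_RInt_pos_primitive with (fun t => - exp (- t)).
  - intros t Ht; unfold Gamma_integrand.
    rewrite Rminus_diag, Rpower_O by assumption.
    auto_derive; [exact I|ring].
  - intros; now apply continuous_Gamma_integrand.
  (* The primitive is continuous at 0, so the one-sided limit follows from the two-sided one. *)
  - apply (filterlim_filter_le_1 _ (filter_le_within (F := locally 0) _)).
    replace (-1) with (- exp (- 0)) by (rewrite Ropp_0, exp_0; ring).
    apply (ex_derive_continuous (fun t => - exp (- t))); now auto_derive.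
  - replace 0 with (- 0) at 1 by ring.
    apply filterlim_comp with (locally 0); [|apply (filterlim_opp 0)].
    apply filterlim_ext with (fun t => exp (- (t / 1))).
    + intros t; now rewrite Rdiv_1_r.
    + apply filterlim_exp_opp_div_p_infty; lra. }
rewrite (is_RInt_pos_unique _ _ _ (Gamma_correct 1 ltac:(lra)) H); ring.
Qed.

(** * Monotonicity and positivity of Gamma *)

(** Write the difference as [t^p * (t^(q-p) - 1)], which is at least [(q - p) * t^p * ln t]. Then
    [t^p * ln t >= t * ln t], because [t^p - t] and [ln t] never have opposite signs, and
    [t * ln t >= t - 1]. *)
Lemma Rpower_sub_ge (p q t : R) : 1 <= p <= q -> 0 < t ->
  (q - p) * (t - 1) <= Rpower t q - Rpower t p.
Proof.
intros Hpq Ht.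
assert (Htl : t - 1 <= t * ln t).
{ pose proof (exp_ineq1_le (- ln t)) as H.
  rewrite exp_Ropp, exp_ln in H by assumption.
  apply Rmult_le_compat_l with (r := t) in H; [|lra].
  rewrite Rinv_r in H; lra. }
assert (Hp1 : t * ln t <= Rpower t p * ln t).
{ unfold Rpower; destruct (Rle_lt_dec 0 (ln t)) as [Hl|Hl].
  - apply Rmult_le_compat_r; [assumption|].
    rewrite <- (exp_ln t) at 1 by assumption.
    apply exp_le.
    assert (0 <= (p - 1) * ln t) by (apply Rmult_le_pos; lra); lra.
  - assert (H1 : exp (p * ln t) <= exp (ln t)).
    { apply exp_le.
      assert (0 <= (p - 1) * - ln t) by (apply Rmult_le_pos; lra); lra. }
    rewrite exp_ln in H1 by assumption.
    assert (0 <= (t - exp (p * ln t)) * - ln t) by (apply Rmult_le_pos; lra).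
    lra. }
replace q with (p + (q - p)) at 2 by ring.
rewrite Rpower_plus.
assert (H1 : (q - p) * ln t <= Rpower t (q - p) - 1)
  by (unfold Rpower; pose proof (exp_ineq1_le ((q - p) * ln t)); lra).
apply Rmult_le_compat_l with (r := Rpower t p) in H1; [|left; apply exp_pos].
assert ((q - p) * (t - 1) <= (q - p) * (Rpower t p * ln t))
  by (apply Rmult_le_compat_l; lra).
lra.
Qed.

Lemma Gamma_le (x y : R) : 2 <= x <= y -> Gamma x <= Gamma y.
Proof.
intros Hxy.
pose proof (Gamma_correct x ltac:(lra)) as Hx.
pose proof (Gamma_correct y ltac:(lra)) as Hy.
pose proof (Gamma_correct 1 ltac:(lra)) as H1.
pose proof (Gamma_correct 2 ltac:(lra)) as H2.
(* The four integrals are merged into one with nonnegative integrand. The threshold 2 makes the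
   smaller exponent [x - 1] at least 1; just above 1, Gamma decreases. *)
pose proof (is_RInt_gen_minus _ _ _ _ (is_RInt_gen_minus _ _ _ _ Hy Hx)
  (is_RInt_gen_scal _ (y - x) _ (is_RInt_gen_minus _ _ _ _ H2 H1))) as H.
apply is_RInt_pos_ge_0 in H.
- assert (E : Gamma 2 = 1).
  { replace 2 with (1 + 1) by ring. rewrite Gamma_succ, Gamma_1; lra. }
  rewrite E, Gamma_1 in H.
  unfold minus, plus, opp, scal in H; simpl in H.
  unfold mult in H; simpl in H; lra.
- intros t Ht.
  unfold minus, plus, opp, scal; simpl; unfold mult; simpl.
  unfold Gamma_integrand.
  replace (2 - 1) with 1 by ring; replace (1 - 1) with 0 by ring.
  rewrite Rpower_1, Rpower_O by assumption.
  pose proof (Rpower_sub_ge (x - 1) (y - 1) t ltac:(lra) Ht) as Hb.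
  pose proof (exp_pos (- t)).
  replace (Rpower t (y - 1) * exp (- t) + - (Rpower t (x - 1) * exp (- t)) +
    - ((y - x) * (t * exp (- t) + - (1 * exp (- t))))) with
    ((Rpower t (y - 1) - Rpower t (x - 1) - (y - 1 - (x - 1)) * (t - 1)) * exp (- t))
    by ring.
  apply Rmult_le_pos; lra.
Qed.

(** Strict positivity comes from [1 = Gamma 2 <= Gamma (x + 1) = x * Gamma x]; nonnegativity of the
    integrand alone would give only a weak inequality. *)
Lemma Gamma_pos (x : R) : 1 <= x -> 0 < Gamma x.
Proof.
intros Hx.
pose proof (Gamma_le 2 (x + 1) ltac:(lra)) as H.
replace 2 with (1 + 1) in H by ring.
rewrite !Gamma_succ, Gamma_1 in H by lra.
apply Rmult_lt_reg_l with x; lra.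
Qed.

(** * Pochhammer symbols and the coefficient bound *)

Lemma Gamma_Pochhammer (x : R) (k : nat) : 1 <= x ->
  Gamma (x + INR k) = Pochhammer x k * Gamma x.
Proof.
intros Hx; induction k as [|k IH].
- simpl; rewrite Rplus_0_r; ring.
- pose proof (pos_INR k).
  rewrite S_INR, <- Rplus_assoc, Gamma_succ, IH by lra; simpl; ring.
Qed.

Lemma Pochhammer_ge_1 (x : R) (k : nat) : 1 <= x -> 1 <= Pochhammer x k.
Proof.
intros Hx; induction k as [|k IH]; simpl; [lra|].
pose proof (pos_INR k).
rewrite <- (Rmult_1_l 1); apply Rmult_le_compat; lra.
Qed.

Lemma Pochhammer_1 (k : nat) : Pochhammer 1 k = INR (fact k).
Proof.
induction k as [|k IH]; [reflexivity|].
change (fact (S k)) with (S k * fact k)%nat.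
rewrite mult_INR, S_INR; simpl; rewrite IH; ring.
Qed.

Lemma Pochhammer_Gamma_le (x m : R) (k : nat) : 1 <= x -> 1 <= m ->
  Pochhammer x k * Gamma x <= Gamma (x + INR k * m).
Proof.
intros Hx Hm; rewrite <- Gamma_Pochhammer by assumption.
destruct k as [|k].
(* At [k = 0] the argument may lie below 2, outside the range of [Gamma_le], but both sides
   coincide. *)
- simpl; rewrite Rmult_0_l; lra.
- apply Gamma_le; rewrite S_INR; pose proof (pos_INR k).
  assert (0 <= (INR k + 1) * (m - 1)) by (apply Rmult_le_pos; lra).
  lra.
Qed.

Lemma Wright_coef_bounds (mu a nu b : R) (k : nat) :
  1 <= a -> 1 <= b -> 1 <= mu -> 1 <= nu ->
  0 <= Wright_coef mu a nu b k <= / (Pochhammer a k * Pochhammer b k).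
Proof.
intros Ha Hb Hmu Hnu; unfold Wright_coef.
pose proof (Gamma_pos a Ha); pose proof (Gamma_pos b Hb).
pose proof (Pochhammer_ge_1 a k Ha); pose proof (Pochhammer_ge_1 b k Hb).
pose proof (Pochhammer_Gamma_le a mu k Ha Hmu).
pose proof (Pochhammer_Gamma_le b nu k Hb Hnu).
assert (0 < Pochhammer a k * Gamma a) by (apply Rmult_lt_0_compat; lra).
assert (0 < Pochhammer b k * Gamma b) by (apply Rmult_lt_0_compat; lra).
assert (0 < Gamma a * Gamma b) by (apply Rmult_lt_0_compat; lra).
split.
- apply Rlt_le, Rdiv_lt_0_compat; [assumption|apply Rmult_lt_0_compat; lra].
- replace (/ (Pochhammer a k * Pochhammer b k)) with
    ((Gamma a * Gamma b) / ((Pochhammer a k * Gamma a) * (Pochhammer b k * Gamma b)))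
    by (field; lra).
  apply Rmult_le_compat_l; [lra|].
  apply Rinv_le_contravar; [now apply Rmult_lt_0_compat|].
  apply Rmult_le_compat; lra.
Qed.

(** * Comparison of the two series *)

(** Domination makes [u] summable, so [CSeries u] is its true sum and not the unspecified value; the
    triangle inequality for partial sums then passes to the limit. *)
Lemma Cmod_CSeries_le (u : nat -> C) (v : nat -> R) :
  (forall n, Cmod (u n) <= v n) -> ex_series v ->
  Cmod (CSeries u) <= Series v.
Proof.
intros Huv Hv.
destruct (ex_series_le (V := C_CompleteNormedModule) u v Huv Hv) as [l Hl].
assert (E : CSeries u = l).
{ apply (iota_unique (V := C_CompleteNormedModule)); [|exact Hl].
  intros y Hy.
  exact (filterlim_locally_unique (V := C_CompleteNormedModule) _ _ _ Hy Hl). }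
rewrite E.
apply (filterlim_le (F := eventually)
  (fun n => Cmod (sum_n (G := C_CompleteNormedModule) u n)) (sum_n v)
  (Cmod l) (Series v)).
- apply filter_forall; intros n.
  apply Rle_trans with (sum_n (fun k => Cmod (u k)) n).
  + apply (norm_sum_n_m (V := C_CompleteNormedModule) u 0 n).
  + now apply sum_n_m_le.
- apply filterlim_comp with (1 := Hl).
  apply (filterlim_norm (V := C_CompleteNormedModule) l).
- exact (Series_correct v Hv).
Qed.

Theorem theorem5p1 (a b mu nu : R) (ha : 1 <= a) (hb : 1 <= b)
    (hmu : 1 <= mu) (hnu : 1 <= nu) (z : C) (hz : Cmod z < 1) :
  Cmod (Wright mu a nu b z) <= Cmod z * hyp1F2 1 a b (Cmod z).
Proof.
unfold Wright, hyp1F2.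
rewrite <- Series_scal_l.
pose proof (Cmod_ge_0 z) as Hz0.
(* [Pochhammer 1 k] cancels the factorial, and the outer factor [Cmod z] raises the power to
   [k + 1], as in the Wright series. *)
assert (Hterm : forall k,
  Cmod z * (Pochhammer 1 k / (Pochhammer a k * Pochhammer b k)
    * (Cmod z ^ k / INR (fact k))) =
  / (Pochhammer a k * Pochhammer b k) * Cmod z ^ (k + 1)).
{ intros k; rewrite Pochhammer_1, pow_add, pow_1.
  pose proof (Pochhammer_ge_1 a k ha); pose proof (Pochhammer_ge_1 b k hb).
  pose proof (INR_fact_neq_0 k); field; lra. }
rewrite (Series_ext _ _ Hterm).
apply Cmod_CSeries_le.
- intros k; rewrite Cmod_mult, Cmod_R, Cmod_pow.
  destruct (Wright_coef_bounds mu a nu b k ha hb hmu hnu).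
  rewrite Rabs_pos_eq by assumption.
  apply Rmult_le_compat_r; [now apply pow_le|assumption].
(* The majorant is summable by comparison with the geometric series: the Pochhammer symbols are at
   least 1 and [Cmod z < 1]. *)
- apply (ex_series_le (V := R_CompleteNormedModule) _ (fun k => Cmod z ^ k)).
  + intros k; unfold norm; simpl; unfold abs; simpl.
    pose proof (Pochhammer_ge_1 a k ha); pose proof (Pochhammer_ge_1 b k hb).
    assert (1 <= Pochhammer a k * Pochhammer b k)
      by (rewrite <- (Rmult_1_l 1); apply Rmult_le_compat; lra).
    assert (Hi : 0 < / (Pochhammer a k * Pochhammer b k) <= 1).
    { split; [apply Rinv_0_lt_compat; lra|].
      rewrite <- Rinv_1; apply Rinv_le_contravar; lra. }
    pose proof (pow_le (Cmod z) k Hz0).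
    rewrite pow_add, pow_1.
    assert (0 <= Cmod z ^ k * Cmod z <= Cmod z ^ k).
    { split; [now apply Rmult_le_pos|].
      rewrite <- (Rmult_1_r (Cmod z ^ k)) at 2; apply Rmult_le_compat_l; lra. }
    rewrite Rabs_pos_eq by (apply Rmult_le_pos; lra).
    rewrite <- (Rmult_1_l (Cmod z ^ k)) at 2; apply Rmult_le_compat; lra.
  + apply ex_series_geom; rewrite Rabs_pos_eq; lra.
Qed.
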